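(* Let $n\ge 1$ and let $X=\{\sigma_1,\dots,\sigma_K\}$ be a finite simplicial complex in $\mathbb{R}^n$ such that every $k$-simplex of $X$ with $k<n$ is a face of an $n$-simplex of $X$, the set $|X|$ is convex, and $X_k=\{\sigma_1,\dots,\sigma_k\}$ is a subcomplex of $X$ for every $1\le k\le K$. Let $\mathbb{X}: \emptyset=X_0\subset X_1\subset\cdots\subset X_K=X$, with homology coefficients in $\mathbb{Z}_2=\mathbb{Z}/2\mathbb{Z}$. Then for every birth-death pair $(b_i,d_i)\in D_{n-1}(\mathbb{X})$ with $d_i<\infty$, the optimal volume for $(b_i,d_i)$ is uniquely determined.
   Context: $|X|\subset\mathbb{R}^n$ is the union of the simplices of $X$. Coefficients are in $\mathbb{Z}_2$. The persistent homology $H_{n-1}(\mathbb{X})$ is the family $H_{n-1}(X_k)$, $0\le k\le K$, with the maps induced by inclusions. It decomposes uniquely as $\bigoplus_{i=1}^p I(b_i,d_i)$ with $b_i<d_i\le\infty$, where the interval module $I(b,d)$ is $\mathbb{Z}_2$ at indices $k$ with $b\le k<d$ and $0$ elsewhere, with identity maps between the nonzero spaces and zero maps otherwise. The persistence diagram is $D_{n-1}(\mathbb{X})=\{(b_i,d_i)\mid i=1,\dots,p\}$. For an $(n-1)$-simplex $\sigma_k$, let $\sigma_k^*$ be the linear functional on $C_{n-1}(X)$ with $\sigma_k^*(\sigma_j)=\delta_{kj}$ for all $(n-1)$-simplices $\sigma_j$. For $(b_i,d_i)\in D_{n-1}(\mathbb{X})$ with $d_i<\infty$ put $\mathcal{F}_m=\{\sigma_k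 \ m\text{-simplex}\mid b_i<k<d_i\}$. A chain $z\in C_n(X)$ is a persistent volume for $(b_i,d_i)$ if: (1) $z=\sigma_{d_i}+\sum_{\sigma_k\in\mathcal{F}_n}\alpha_k\sigma_k$ for some $\alpha_k\in\mathbb{Z}_2$; (2) $\tau^*(\partial z)=0$ for all $\tau\in\mathcal{F}_{n-1}$; (3) $\sigma_{b_i}^*(\partial z)\ne 0$. An optimal volume for $(b_i,d_i)$ is a persistent volume $z$ minimizing $\|z\|_0$, the number of $n$-simplices with nonzero coefficient in $z$, among all persistent volumes for $(b_i,d_i)$. *)

(* Defs.v *)
From HB Require Import structures.
From mathcomp Require Import all_boot all_order all_algebra finmap.
From mathcomp Require Import classical_sets reals convex.

Set Implicit Arguments.
Unset Strict Implicit.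
Unset Printing Implicit Defensive.

Import Order.TTheory GRing.Theory Num.Theory.

Local Open Scope fset_scope.
Local Open Scope ring_scope.

Section GeometricComplex.
Variables (R : realType) (n : nat).
Local Notation point := 'rV[R]_n.

(* A simplex is given by its finite set of vertices, so faces are subsets. *)
Definition simplex := {fset point}.

Definition affinely_independent (s : simplex) : Prop :=
  forall c : point -> R,
    \sum_(v <- s) c v = 0 -> \sum_(v <- s) c v *: v = 0 ->
    forall v, v \in s -> c v = 0.

Definition hull (s : simplex) : set point :=
  [set x | exists c : point -> R,
    [/\ forall v, v \in s -> 0 <= c v,
        \sum_(v <- s) c v = 1 &
        x = \sum_(v <- s) c v *: v]]%classic.

Definition has_dim (m : nat) (s : simplex) : bool := #|` s| == m.+1.

Definition face_closed (X : {fset simplex}) : Prop :=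
  forall s t : simplex, s \in X -> t `<=` s -> t != fset0 -> t \in X.

(* Two simplices meet in a common face; this face may be empty, since
   hull fset0 is the empty set. *)
Definition simplicial_complex (X : {fset simplex}) : Prop :=
  [/\ forall s, s \in X -> s != fset0 /\ affinely_independent s,
      face_closed X &
      forall s t, s \in X -> t \in X ->
        exists u : simplex,
          [/\ u `<=` s, u `<=` t & (hull s `&` hull t)%classic = hull u]].

Definition subcomplex (Y X : {fset simplex}) : Prop :=
  Y `<=` X /\ face_closed Y.

Definition polyhedron (X : {fset simplex}) : set point :=
  [set x | exists2 s, s \in X & hull s x]%classic.

End GeometricComplex.

Section QuotientSpace.
Variables (F : fieldType) (V : vectType F) (U : {vspace V}).

Definition quotv : Type := Quotient.quot (pred_of_vspace U).

HB.instance Definition _ := GRing.Zmodule.on quotv.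

Definition clsv (v : V) : quotv := \pi_(Quotient.quot (pred_of_vspace U))%qT v.
Definition reprv (x : quotv) : V := repr (x : Quotient.quot (pred_of_vspace U)).

Lemma reprvK : cancel reprv clsv.
Proof. by move=> x; rewrite /clsv /reprv reprK. Qed.

Lemma clsv_eq v w : (clsv v == clsv w) = (v - w \in U).
Proof. by rewrite Quotient.idealrBE. Qed.

Lemma clsvD : {morph clsv : v w / v + w}.
Proof. by move=> v w; rewrite /clsv Quotient.pi_add. Qed.

Definition scalev (a : F) (x : quotv) : quotv := clsv (a *: reprv x).

Lemma clsvZ a v : clsv (a *: v) = scalev a (clsv v).
Proof.
apply/eqP; rewrite clsv_eq -scalerBr memvZ// -clsv_eq reprvK//.
Qed.

Lemma scalevA a b x : scalev a (scalev b x) = scalev (a * b) x.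
Proof. by rewrite -[x]reprvK -!clsvZ scalerA. Qed.

Lemma scale1v : left_id 1 scalev.
Proof. by move=> x; rewrite -[x]reprvK -clsvZ scale1r. Qed.

Lemma scalevDr : right_distributive scalev +%R.
Proof.
by move=> a x y; rewrite -[x]reprvK -[y]reprvK -!(clsvZ, clsvD) scalerDr.
Qed.

Lemma scalevDl x : {morph scalev^~ x : a b / a + b}.
Proof. by move=> a b; rewrite -[x]reprvK -!clsvZ -clsvD scalerDl. Qed.

HB.instance Definition _ := GRing.Zmodule_isLmodule.Build F quotv
  scalevA scale1v scalevDr scalevDl.

Lemma clsv_is_linear : linear clsv.
Proof. by move=> a v w; rewrite clsvD clsvZ. Qed.

HB.instance Definition _ := GRing.isSemilinear.Build F V quotv _ clsv
  (GRing.semilinear_linear clsv_is_linear).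

End QuotientSpace.

Section PersistenceModule.
Variables (F : fieldType) (K : nat).

Record persmod := Persmod {
  pm_space :> 'I_K.+1 -> lmodType F;
  pm_map : forall i j : 'I_K.+1, (i <= j)%N ->
    {linear pm_space i -> pm_space j};
  pm_id : forall (i : 'I_K.+1) (ii : (i <= i)%N) x, pm_map ii x = x;
  pm_comp : forall (i j k : 'I_K.+1)
      (ij : (i <= j)%N) (jk : (j <= k)%N) (ik : (i <= k)%N) x,
    pm_map ik x = pm_map jk (pm_map ij x) }.

Definition pm_iso (M N : persmod) : Prop :=
  exists phi : forall k, {linear M k -> N k},
    (forall k, bijective (phi k)) /\
    forall (i j : 'I_K.+1) (ij : (i <= j)%N) x,
      phi j (pm_map M ij x) = pm_map N ij (phi i x).

(* (b, Some d) and (b, None) stand for the intervals b <= k < d and b <= k. *)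
Definition bar := ('I_K.+1 * option 'I_K.+1)%type.

Definition bar_valid (p : bar) : bool :=
  if p.2 is Some d then (p.1 < d)%N else true.

Definition alive (p : bar) (k : nat) : bool :=
  (p.1 <= k)%N && (if p.2 is Some d then (k < d)%N else true).

(* 'rV_(alive p k) has dimension 1 when k lies in the interval, and 0
   otherwise; pid_mx 1 is the identity between two lines. *)
Definition interval_space (p : bar) (k : 'I_K.+1) : lmodType F :=
  'rV[F]_(alive p k).

Definition interval_map (p : bar) (i j : 'I_K.+1) (ij : (i <= j)%N) :
    {linear interval_space p i -> interval_space p j} :=
  mulmxr (pid_mx 1 : 'M[F]_(alive p i, alive p j)).

Lemma interval_id p (i : 'I_K.+1) (ii : (i <= i)%N) x :
  interval_map p ii x = x.
Proof.
suff E : (pid_mx 1 : 'M[F]_(alive p i)) = 1%:M by rewrite /= E mulmx1.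
by case: (alive p i); [rewrite pid_mx_1 | apply/matrixP => -[]].
Qed.

Lemma interval_comp p (i j k : 'I_K.+1)
    (ij : (i <= j)%N) (jk : (j <= k)%N) (ik : (i <= k)%N) x :
  interval_map p ik x = interval_map p jk (interval_map p ij x).
Proof.
rewrite /= -mulmxA mul_pid_mx; congr (_ *m _).
have : alive p i && alive p k ==> alive p j.
  apply/implyP; rewrite /alive => /andP[/andP[bi _] /andP[_ kd]].
  rewrite (leq_trans bi ij); case: p.2 kd => //= d kd.
  exact: leq_ltn_trans jk kd.
case: (alive p i); case: (alive p j); case: (alive p k) => //= _;
  by apply/matrixP => -[[|a] ha] // [[|c] hc].
Qed.

Definition interval_pm (p : bar) : persmod :=
  Persmod (@interval_id p) (@interval_comp p).

Section PairMap.
Variables (A B C D : lmodType F) (f : {linear A -> C}) (g : {linear B -> D}).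

Definition pair_map (x : A * B) : C * D := (f x.1, g x.2).

Lemma pair_map_is_linear : linear pair_map.
Proof. by move=> a x y; rewrite /pair_map !linearP. Qed.

HB.instance Definition _ := GRing.isSemilinear.Build F (A * B)%type
  (C * D)%type _ pair_map (GRing.semilinear_linear pair_map_is_linear).
End PairMap.

Section DirectSum.
Variables M N : persmod.

Definition sum_space (k : 'I_K.+1) : lmodType F := (M k * N k)%type.

Definition sum_map (i j : 'I_K.+1) (ij : (i <= j)%N) :
    {linear sum_space i -> sum_space j} :=
  pair_map (pm_map M ij) (pm_map N ij).

Lemma sum_id (i : 'I_K.+1) (ii : (i <= i)%N) x : sum_map ii x = x.
Proof. by case: x => x y; rewrite /= /pair_map !pm_id. Qed.

Lemma sum_comp (i j k : 'I_K.+1)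
    (ij : (i <= j)%N) (jk : (j <= k)%N) (ik : (i <= k)%N) x :
  sum_map ik x = sum_map jk (sum_map ij x).
Proof. by rewrite /= /pair_map (pm_comp ij jk) (pm_comp ij jk ik). Qed.

Definition sum_pm : persmod := Persmod sum_id sum_comp.
End DirectSum.

Definition zero_space (k : 'I_K.+1) : lmodType F := 'rV[F]_0.

Definition zero_map (i j : 'I_K.+1) (ij : (i <= j)%N) :
  {linear zero_space i -> zero_space j} := \0.

Lemma zero_id (i : 'I_K.+1) (ii : (i <= i)%N) x : zero_map ii x = x.
Proof. by rewrite [x]thinmx0. Qed.

Lemma zero_comp (i j k : 'I_K.+1)
    (ij : (i <= j)%N) (jk : (j <= k)%N) (ik : (i <= k)%N) x :
  zero_map ik x = zero_map jk (zero_map ij x).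
Proof. by []. Qed.

Definition zero_pm : persmod := Persmod zero_id zero_comp.

Definition intervals_pm (D : seq bar) : persmod :=
  foldr (fun p M => sum_pm (interval_pm p) M) zero_pm D.

(* The sequence D represents a multiset. *)
Definition persistence_diagram (M : persmod) (D : seq bar) : Prop :=
  all bar_valid D /\ pm_iso M (intervals_pm D).

End PersistenceModule.

Section Filtration.
Variables (R : realType) (n K : nat) (sigma : 'I_K -> simplex R n).
Local Notation Z2 := 'F_2.

(* The simplex sigma i, with i : 'I_K, is the (i + 1)-st one, sigma_(i+1). *)
Definition stage (k : nat) : {fset simplex R n} :=
  [fset sigma i | i : 'I_K & (i < k)%N]%fset.

(* Chains of all dimensions: z 0 i is the coefficient of sigma i. *)
Definition chain := 'rV[Z2]_K.

Definition chains (m k : nat) : {vspace chain} :=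
  (\sum_(i < K | (i < k)%N && has_dim m (sigma i))
     <[delta_mx 0%R i : chain]>)%VS.

Definition boundary_mx : 'M[Z2]_K :=
  \matrix_(i, j) ((sigma j `<=` sigma i)
                  && (#|` sigma i| == #|` sigma j|.+1))%:R.

Definition boundary : 'End(chain) := linfun (mulmxr boundary_mx).

Definition cycles (m k : nat) : {vspace chain} :=
  (chains m k :&: lker boundary)%VS.

Definition boundaries (m k : nat) : {vspace chain} :=
  (boundary @: chains m.+1 k)%VS.

Definition boundaries_in_cycles (m k : nat) : {vspace subvs_of (cycles m k)} :=
  (linfun vsval @^-1: boundaries m k)%VS.

Definition homology (m : nat) (k : 'I_K.+1) : lmodType Z2 :=
  quotv (boundaries_in_cycles m k).

Lemma chains_sub m k l : (k <= l)%N -> (chains m k <= chains m l)%VS.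
Proof.
move=> kl; apply/subv_sumP => i /andP[ik mi].
by rewrite (sumv_sup i)// (leq_trans ik kl).
Qed.

Lemma cycles_sub m k l : (k <= l)%N -> (cycles m k <= cycles m l)%VS.
Proof. by move=> kl; rewrite capvS// chains_sub. Qed.

Lemma boundaries_sub m k l :
  (k <= l)%N -> (boundaries m k <= boundaries m l)%VS.
Proof. by move=> kl; rewrite limgS// chains_sub. Qed.

Section InclusionMap.
Variables (m : nat) (i j : 'I_K.+1) (ij : (i <= j)%N).

Definition cycle_incl (z : subvs_of (cycles m i)) : subvs_of (cycles m j) :=
  vsproj (cycles m j) (vsval z).

Lemma vsval_cycle_incl z : vsval (cycle_incl z) = vsval z.
Proof. by rewrite vsprojK// (subvP (cycles_sub m ij))// subvsP. Qed.

Definition homology_fun (x : homology m i) : homology m j :=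
  clsv (boundaries_in_cycles m j) (cycle_incl (reprv x)).

Lemma homology_fun_cls z :
  homology_fun (clsv _ z) = clsv (boundaries_in_cycles m j) (cycle_incl z).
Proof.
apply/eqP; rewrite clsv_eq -memv_preim lfunE/= !vsval_cycle_incl.
apply: (subvP (boundaries_sub m ij)).
have : reprv (clsv (boundaries_in_cycles m i) z) - z
         \in boundaries_in_cycles m i by rewrite -clsv_eq reprvK.
by rewrite -memv_preim lfunE.
Qed.

Lemma homology_fun_is_linear : linear homology_fun.
Proof.
move=> a x y; rewrite -[x]reprvK -[y]reprvK -linearP !homology_fun_cls.
by rewrite /cycle_incl -!linearP.
Qed.

HB.instance Definition _ := GRing.isSemilinear.Build Z2 (homology m i)
  (homology m j) _ homology_fun
  (GRing.semilinear_linear homology_fun_is_linear).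

Definition homology_map : {linear homology m i -> homology m j} :=
  homology_fun.

End InclusionMap.

Lemma homology_map_id m (i : 'I_K.+1) (ii : (i <= i)%N) x :
  homology_map m ii x = x.
Proof.
rewrite -[x]reprvK /= homology_fun_cls//; congr clsv.
by apply: val_inj; rewrite /= vsval_cycle_incl.
Qed.

Lemma homology_map_comp m (i j k : 'I_K.+1)
    (ij : (i <= j)%N) (jk : (j <= k)%N) (ik : (i <= k)%N) x :
  homology_map m ik x = homology_map m jk (homology_map m ij x).
Proof.
rewrite -[x]reprvK /= !homology_fun_cls//; congr clsv.
by apply: val_inj; rewrite /= !vsval_cycle_incl.
Qed.

Definition persistent_homology (m : nat) : persmod Z2 K :=
  Persmod (@homology_map_id m) (@homology_map_comp m).

(* The basis chain sigma_k and its dual functional sigma_k^*, for the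
   1-based index k. *)
Definition simplex_chain (k : nat) : chain := \row_i (i.+1 == k)%:R.

Definition coef (k : nat) (z : chain) : Z2 := \sum_(i < K | i.+1 == k) z 0 i.

(* i : 'I_K belongs to between b d m iff sigma_(i+1) lies in the set F_m
   attached to the pair (b, d). *)
Definition between (b d m : nat) : pred 'I_K :=
  fun i => (b < i.+1 < d)%N && has_dim m (sigma i).

Definition persistent_volume (b d : nat) (z : chain) : Prop :=
  [/\ z \in chains n K,
      exists alpha : 'I_K -> Z2,
        z = simplex_chain d
            + \sum_(i | between b d n i) alpha i *: simplex_chain i.+1,
      forall i, between b d n.-1 i -> coef i.+1 (boundary z) = 0 &
      coef b (boundary z) != 0].

Definition norm0 (z : chain) : nat :=
  #|[set i | has_dim n (sigma i) & z 0 i != 0]|.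

Definition optimal_volume (b d : nat) (z : chain) : Prop :=
  persistent_volume b d z /\
  forall z', persistent_volume b d z' -> (norm0 z <= norm0 z')%N.

End Filtration.

(* Main.v *)
Require Import Defs.
From mathcomp Require Import all_boot all_order all_algebra finmap.
From mathcomp Require Import classical_sets reals convex boolp.
From mathcomp Require Import ring.

Set Implicit Arguments.
Unset Strict Implicit.
Unset Printing Implicit Defensive.

Import Order.TTheory GRing.Theory Num.Theory.

Local Open Scope fset_scope.
Local Open Scope ring_scope.

(** Over the field with two elements, chains are sets of simplices.  The
    persistent volumes of a birth-death pair are closed under intersection, so
    two optimal volumes both coincide with their intersection, and are equal.

    Two facts make intersections work.  The first is geometric: in a simplicial
    complex in dimension n, an (n-1)-simplex is a face of at most two n-simplices
    ([no_three_cofaces]), since it spans a hyperplane and two n-simplices on the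
    same side of it would overlap near its barycenter.  Therefore a set of
    n-simplices whose boundary avoids a given (n-1)-simplex contains both or
    neither of its cofaces, a condition that passes to intersections
    ([boundary_meet]).  The second is homological: if z and z' are persistent
    volumes for (b, d), then z minus its intersection with z' lacks the simplex
    of index d, so its boundary is a cycle that bounds before d; such a cycle
    cannot contain the simplex of index b, because the only class born at b
    survives until d ([paired_death]).  Hence the boundary of the intersection
    still contains that simplex ([persistent_volume_meet]).

    Persistent volumes exist ([persistent_volume_exists]): a representative of the
    class born at b bounds a chain at d, from which the simplices older than b
    can be discarded.  What the interval decomposition says about the pair is
    first extracted as a linear functional on the homology at b
    ([persistence_diagram_splits]), then as a property of cycles and boundaries
    ([splits_bar_paired]). *)

(** * Cofaces in a geometric complex *)

Section Geometry.
Variables (R : realType) (n : nat).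
Local Notation point := 'rV[R]_n.
Implicit Types (s t : simplex R n) (v w : point).

(** Appending a coordinate 1 turns affine dependence in dimension n into linear
    dependence in dimension n + 1, where rank is bounded. *)
Lemma affine_dependence s : (n.+1 < #|` s|)%N ->
  exists c : point -> R,
    [/\ \sum_(v <- s) c v = 0, \sum_(v <- s) c v *: v = 0
      & exists2 v, v \in s & c v != 0].
Proof.
move=> big_s; set m := #|` s| in big_s; pose e (i : 'I_m) : point := nth 0 s i.
pose A : 'M[R]_(m, n + 1) := \matrix_(i < m) row_mx (e i) 1%:M.
have: kermx A != 0.
  rewrite kermx_eq0 /row_free; apply/eqP => rA.
  by have := rank_leq_col A; rewrite rA addn1 leqNgt big_s.
case/rowV0Pn => u /sub_kermxP uA u0.
have e_inj : injective e.
  move=> i j /eqP; rewrite nth_uniq ?fset_uniq// => /eqP ij; exact: val_inj.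
have sumE (V : nmodType) (F : point -> V) : \sum_(v <- s) F v = \sum_i F (e i).
  by rewrite (big_nth 0) big_mkord.
pose c v := \sum_(i | e i == v) u 0 i.
have ce i : c (e i) = u 0 i.
  by rewrite /c (big_pred1 i)// => j; rewrite (inj_eq e_inj).
have : row_mx (\sum_i u 0 i *: e i) (\sum_i u 0 i)%:M = 0 :> 'rV_(n + 1).
  rewrite -uA mulmx_sum_row.
  rewrite [RHS](eq_bigr (fun i => row_mx (u 0 i *: e i) (u 0 i)%:M)).
    rewrite (big_morph (fun x : R => x%:M : 'M_1) (id1 := 0) (op1 := +%R))/=;
      first last.
    - by rewrite raddf0.
    - by move=> x y; rewrite raddfD.
    elim/big_ind3: _ => [|? ? ? ? ? ? <- <-|//];
      by rewrite ?row_mx0 ?add_row_mx.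
  by move=> i _; rewrite rowK scale_row_mx scalemx1.
rewrite -row_mx0 => /eq_row_mx[ue /matrixP/(_ 0 0)]; rewrite !mxE eqxx => u1.
exists c; split.
- by rewrite sumE (eq_bigr (fun i => u 0 i)).
- by rewrite sumE -[RHS]ue; apply: eq_bigr => i _; rewrite ce.
case/rV0Pn: u0 => i ui; exists (e i); last by rewrite ce.
exact: mem_nth.
Qed.

(** [a] is the coordinate of [w] along [v] in the affine frame [v |` t].  When
    [t] spans a hyperplane, the sign of [a] tells whether [v] and [w] are on the
    same side of it. *)
Definition affine_coord (t : simplex R n) v w a :=
  exists c : point -> R, a + \sum_(x <- t) c x = 1 /\
    w = a *: v + \sum_(x <- t) c x *: x.

Lemma sum_fset1U (V : nmodType) t v (F : point -> V) : v \notin t ->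
  \sum_(x <- v |` t) F x = F v + \sum_(x <- t) F x.
Proof. by move=> vt; rewrite big_fsetU1. Qed.

(** The n + 2 points [v], [w] and [t] are affinely dependent.  Neither [v] nor [w]
    can have coefficient 0 in a dependence, because removing one of them leaves
    an independent set; dividing by the coefficient of [w] gives the coordinate. *)
Lemma affine_coord_exists t v w :
    v \notin t -> w \notin t -> v != w -> #|` t| = n ->
    affinely_independent (v |` t) -> affinely_independent (w |` t) ->
  exists2 a, a != 0 & affine_coord t v w a.
Proof.
move=> vt wt vw tn av aw.
have wvt : w \notin v |` t by rewrite !inE negb_or eq_sym vw.
have [|c [c1 cx [x0 x0in cx0]]] := @affine_dependence (w |` (v |` t)).
  by rewrite !cardfsU1 wvt vt tn.
move: c1 cx; rewrite !sum_fset1U// => c1 cx.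
have cw : c w != 0.
  apply: contraNneq cx0 => cw; rewrite cw add0r scale0r add0r in c1 cx.
  move: x0in; rewrite in_fset1U => /predU1P[->|x0in]; first by rewrite cw.
  by apply/eqP; apply: (av) x0in; rewrite sum_fset1U.
have cv : c v != 0.
  apply: contraNneq cw => cv; apply/eqP; apply: (aw); last exact: fset1U1.
    by rewrite sum_fset1U// -[RHS]c1 cv add0r.
  by rewrite sum_fset1U// -[RHS]cx cv scale0r add0r.
exists (- (c v / c w)); first by rewrite oppr_eq0 mulf_neq0 ?invr_eq0.
exists (fun x => - (c x / c w)); split.
  have -> : \sum_(x <- t) - (c x / c w) = - ((\sum_(x <- t) c x) / c w).
    by rewrite mulr_suml sumrN.
  move: c1 => /eqP; rewrite addrA addrC addr_eq0 => /eqP ->; by field.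
have -> : \sum_(x <- t) - (c x / c w) *: x
          = - (c w)^-1 *: \sum_(x <- t) c x *: x.
  by rewrite scaler_sumr; apply: eq_bigr => x _; rewrite scalerA mulNr mulrC.
move: cx => /eqP; rewrite addrA addrC addr_eq0 => /eqP ->.
rewrite scalerN !scaleNr opprK scalerDr !scalerA mulVf// scale1r addrCA.
by rewrite [_^-1 * _]mulrC addNr addr0.
Qed.

(** Change of frame: both [w] and [w'] are expressed along [v], and [v] is
    eliminated. *)
Lemma affine_coord_div t v w w' a a' : a != 0 ->
  affine_coord t v w a -> affine_coord t v w' a' -> affine_coord t w w' (a' / a).
Proof.
move=> a0 [c [c1 cw]] [c' [c'1 cw']].
exists (fun x => c' x - a' / a * c x); split.
  rewrite big_split/= sumrN -mulr_sumr; move: c1 c'1.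
  move=> /(canRL (addKr _)) -> /(canRL (addKr _)) ->; by field.
under eq_bigr do rewrite scalerBl -scalerA.
rewrite big_split/= sumrN -scaler_sumr.
rewrite cw' cw scalerDr scalerA divfK//.
by rewrite -addrA [a' / a *: _ + _]addrC subrK.
Qed.

(** Two simplices on a common facet [t] and on the same side of it overlap: the
    point obtained from the facet by a small push towards [w] lies in both, yet
    off the hyperplane of [t].  The axioms of a complex put it in the hull of a
    common face, hence of a subset of [t], which contradicts the affine
    independence of [w |` t]. *)
Lemma affine_coord_le0 (X : {fset simplex R n}) t v w a :
    simplicial_complex X -> v |` t \in X -> w |` t \in X ->
    v \notin t -> w \notin t -> v != w -> affine_coord t v w a -> a <= 0.
Proof.
case=> X1 _ X3 vX wX vt wt vw [c [c1 cw]]; rewrite leNgt; apply/negP => a0.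
(* The weights M on t outweigh the possibly negative coordinates c of w, so that
   p is a convex combination in both frames. *)
pose M := \sum_(x <- t) `|c x|; pose S := 1 + \sum_(x <- t) M.
have M0 : 0 <= M by apply: sumr_ge0.
have S0 : 0 < S by rewrite ltr_pwDl ?sumr_ge0.
have cM x : x \in t -> 0 <= c x + M.
  move=> xt; rewrite -lerBlDl sub0r; apply: le_trans (ler_norm _) _.
  rewrite normrN /M (big_fsetD1 x)//= lerDl; exact: sumr_ge0.
have neq x y : x \in t -> y \notin t -> (x == y) = false.
  by move=> xt; apply: contraNF => /eqP <-.
pose p := S^-1 *: (w + \sum_(x <- t) M *: x).
have pw : hull (w |` t) p.
  exists (fun x => (if x == w then 1 else M) / S); split.
  - by move=> x _; case: ifP => _; rewrite divr_ge0// ltW.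
  - rewrite -mulr_suml sum_fset1U// eqxx.
    rewrite (eq_big_seq (fun=> M)) ?divff ?gt_eqF// => x xt.
    by rewrite neq.
  - rewrite sum_fset1U// eqxx /p scalerDr mul1r; congr (_ + _).
    rewrite scaler_sumr; apply: eq_big_seq => x xt.
    by rewrite neq// scalerA mulrC.
have pv : hull (v |` t) p.
  exists (fun x => (if x == v then a else c x + M) / S); split.
  - move=> x; rewrite in_fset1U; case: eqP => /= [_ _|_ xt].
      by rewrite divr_ge0// ltW.
    by rewrite divr_ge0 ?cM// ltW.
  - rewrite -mulr_suml sum_fset1U// eqxx.
    rewrite (eq_big_seq (fun x => c x + M)); last by move=> x xt; rewrite neq.
    by rewrite big_split/= addrA c1 divff ?gt_eqF.
  - rewrite sum_fset1U// eqxx /p cw mulrC -addrA scalerDr scalerA.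
    congr (_ + _); rewrite -big_split/= scaler_sumr; apply: eq_big_seq => x xt.
    by rewrite neq// mulrC -scalerA scalerDl.
have [u [uv uw uE]] := X3 _ _ vX wX.
have : hull u p by rewrite -uE; split.
case=> e [_ e1 pe].
have ut : u `<=` t.
  apply/fsubsetP => x xu.
  have := fsubsetP uv _ xu; have := fsubsetP uw _ xu; rewrite !in_fset1U.
  by case/predU1P => [->|//] /predU1P[vw'|//]; rewrite vw' eqxx in vw.
have [_ aw] := X1 _ wX.
(* Subtracting the two expressions of p, the one through w and the one through
   u, gives an affine dependence of w |` t whose coefficient at w is 1 / S. *)
pose f x := (if x == w then S^-1 else M / S - (if x \in u then e x else 0)).
have eu (V : nmodType) (F : point -> V) :
    \sum_(x <- u) F x = \sum_(x <- t) (if x \in u then F x else 0).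
  rewrite -[RHS](big_fset_incl _ ut) => [|x _ /negPf->//].
  by apply: eq_big_seq => x ->.
suff : f w = 0 by rewrite /f eqxx => /eqP; rewrite invr_eq0 gt_eqF.
apply: (aw); last exact: fset1U1.
  rewrite sum_fset1U// /f eqxx.
  rewrite (eq_big_seq (fun x => M / S - (if x \in u then e x else 0))); last first.
    by move=> x xt; rewrite neq.
  rewrite big_split/= sumrN -eu e1 -mulr_suml.
  have -> : \sum_(x <- t) M = S - 1 by rewrite /S [1 + _]addrC addrK.
  by field; rewrite gt_eqF.
rewrite sum_fset1U// /f eqxx.
rewrite (eq_big_seq (fun x => (M / S) *: x - (if x \in u then e x *: x else 0))).
  rewrite big_split/= sumrN -eu -pe /p scalerDr scaler_sumr.
  under eq_bigr do rewrite mulrC -scalerA.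
  by rewrite addrA subrr.
move=> x xt; rewrite neq// scalerBl; case: ifP => //; by rewrite scale0r.
Qed.

(** Two of the three apices [v1], [v2], [v3] would be on the same side of the
    hyperplane spanned by [t]: if [v2] and [v3] are both opposite to [v1], then the
    coordinate of [v3] along [v2] is a quotient of two negative numbers. *)
Lemma no_three_cofaces (X : {fset simplex R n}) t v1 v2 v3 :
    simplicial_complex X -> #|` t| = n ->
    v1 |` t \in X -> v2 |` t \in X -> v3 |` t \in X ->
    v1 \notin t -> v2 \notin t -> v3 \notin t ->
    v1 != v2 -> v2 != v3 -> v3 != v1 -> False.
Proof.
move=> Xc tn X1 X2 X3 t1 t2 t3 v12 v23 v31.
have [Xa _ _] := Xc.
have [_ a1] := Xa _ X1; have [_ a2] := Xa _ X2; have [_ a3] := Xa _ X3.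
have [a a_neq0 ra] := affine_coord_exists t1 t2 v12 tn a1 a2.
have [|a' a'_neq0 ra'] := affine_coord_exists t1 t3 _ tn a1 a3.
  by rewrite eq_sym.
have a_le0 := affine_coord_le0 Xc X1 X2 t1 t2 v12 ra.
have a'_le0 : a' <= 0.
  by apply: affine_coord_le0 Xc X1 X3 t1 t3 _ ra'; rewrite eq_sym.
have := affine_coord_le0 Xc X2 X3 t2 t3 v23 (affine_coord_div a_neq0 ra ra').
rewrite leNgt nmulr_rgt0 ?invr_lt0 ?lt_neqAle ?a_neq0 ?a'_neq0 ?a_le0 ?a'_le0//.
Qed.
End Geometry.

(** * Bars of a persistence module *)

Section Bars.
Variables (F : fieldType) (K : nat).
Implicit Types (M N : persmod F K) (b d : 'I_K.+1).

(** What is needed of an interval summand with birth [b] and death [d]: its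
    generator [g], and the projection [lam] onto it at index [b] only.  The last
    two conditions say that [lam] sees neither the classes born before [b] nor
    the classes dying before [d]. *)
Definition splits_bar M b d : Prop :=
  exists (g : M b) (lam : {linear M b -> F^o}),
    [/\ lam g = 1,
        forall bd : (b <= d)%N, pm_map M bd g = 0,
        forall (i : 'I_K.+1) (ib : (i <= b)%N) (y : M i),
          (i < b)%N -> lam (pm_map M ib y) = 0
      & forall (k : 'I_K.+1) (bk : (b <= k)%N) (x : M b),
          (k < d)%N -> pm_map M bk x = 0 -> lam x = 0].

Lemma splits_bar_interval b d : (b < d)%N ->
  splits_bar (interval_pm F (b, Some d)) b d.
Proof.
move=> bd; pose p : bar K := (b, Some d).
have ab : alive p b by rewrite /alive /= leqnn.
pose lam := @mxtrace F 1 \o mulmxr (const_mx 1 : 'M[F]_(alive p b, 1)).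
exists (const_mx 1 : 'rV_(alive p b)), lam; split.
- rewrite /lam /= trace_mx11 mxE; under eq_bigr do rewrite !mxE mulr1.
  by rewrite sumr_const card_ord ab.
- move=> bd'; rewrite /= /interval_space.
  have -> : alive (b, Some d) d = false by rewrite /alive /= ltnn andbF.
  by rewrite [LHS]thinmx0.
- move=> i ib y ilt; rewrite /= /interval_space in y *.
  have ai : alive (b, Some d) i = false by rewrite /alive /= leqNgt ilt.
  by move: y; rewrite ai => y; rewrite [y]thinmx0 mul0mx /= mul0mx mxtrace0.
- move=> k bk x kd; rewrite /= /interval_space in x *.
  have ak : alive (b, Some d) k = true by rewrite /alive /= bk kd.
  move: x; rewrite /lam ak /p; case: (alive (b, Some d) b) => x.
    by rewrite pid_mx_1 mulmx1 => ->; rewrite /= mul0mx mxtrace0.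
  by rewrite [x]thinmx0 /= !mul0mx mxtrace0.
Qed.

Lemma splits_bar_sum M N b d :
  splits_bar M b d \/ splits_bar N b d -> splits_bar (sum_pm M N) b d.
Proof.
case=> -[g [lam [lg gd old young]]].
- exists ((g, 0) : sum_space M N b), (lam \o fst); split => //.
  + by move=> bd; rewrite /= /pair_map /= gd linear0.
  + by move=> i ib y ilt; apply: old.
  + by move=> k bk x kd [] /(young _ _ _ kd) ? _.
- exists ((0, g) : sum_space M N b), (lam \o snd); split => //.
  + by move=> bd; rewrite /= /pair_map /= gd linear0.
  + by move=> i ib y ilt; apply: old.
  + by move=> k bk x kd [] _ /(young _ _ _ kd) ?.
Qed.

Lemma splits_bar_iso M N b d :
  pm_iso M N -> splits_bar N b d -> splits_bar M b d.
Proof.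
case=> phi [bij nat] [g [lam [lg gd old young]]].
have [psi phiK psiK] := bij b.
exists (psi g), (lam \o phi b); split.
- by rewrite /= psiK.
- move=> bd; apply: (bij_inj (bij d)).
  by rewrite nat psiK gd linear0.
- by move=> i ib y ilt; rewrite /= nat old.
- by move=> k bk x kd xk; apply: (young k bk) => //; rewrite -nat xk linear0.
Qed.

(** The conditions of [splits_bar] hold for an interval module, are inherited
    by direct sums from either summand, and are carried along isomorphisms. *)
Lemma persistence_diagram_splits M (D : seq (bar K)) b d :
  persistence_diagram M D -> (b, Some d) \in D -> splits_bar M b d.
Proof.
case=> + iso bdD; move=> valid; apply: splits_bar_iso iso _.
elim: D bdD valid => //= p D IH.
rewrite inE => /predU1P[<-|bdD] /andP[pv valid]; apply: splits_bar_sum.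
  by left; apply: splits_bar_interval.
by right; apply: IH.
Qed.
End Bars.

(** * Chains and birth-death pairs *)

Section Chains.
Variables (R : realType) (n K : nat) (sigma : 'I_K -> simplex R n).
Implicit Types (z c : chain K) (m k : nat).

Lemma mem_chainsP m k z :
  reflect (forall i, z 0 i != 0 -> (i < k)%N && has_dim m (sigma i))
          (z \in chains sigma m k).
Proof.
apply: (iffP idP) => [/memv_sumP[v vP ->] i|zP].
  rewrite summxE => /eqP; case: (boolP ((i < k)%N && _)) => // nP [].
  rewrite big1// => j jP; have /vlineP[a ->] := vP j jP.
  rewrite !mxE eqxx; case: eqP => [ij|_] /=; last by rewrite mulr0.
  by rewrite ij jP in nP.
rewrite [z]row_sum_delta
  (bigID (fun i : 'I_K => (i < k)%N && has_dim m (sigma i)))/=.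
rewrite [X in _ + X]big1 ?addr0.
  by apply: memv_sumr => i iP; rewrite memvZ// memv_line.
move=> i iP; case: (eqVneq (z 0 i) 0) => [->|/zP]; first by rewrite scale0r.
by rewrite (negPf iP).
Qed.

Lemma chains0 m : chains sigma m 0 = 0%VS.
Proof. by rewrite /chains big_pred0. Qed.

Lemma boundaryE z j :
  boundary sigma z 0 j = \sum_i z 0 i * boundary_mx sigma i j.
Proof. by rewrite lfunE /= mxE. Qed.

(** A bar [(b, d)] in terms of chains, without quotients: [c] bounds at [d], and no
    cycle differing from [c] by an older cycle bounds before [d].  Taking
    [c' = c] shows that [c] itself does not bound earlier, and [c' = 0] shows that
    [c] is not older than [b]. *)
Definition paired m (b d : nat) c : Prop :=
  [/\ c \in cycles sigma m b, c \in boundaries sigma m d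
    & forall c', c' \in cycles sigma m b -> c - c' \in cycles sigma m b.-1 ->
      c' \notin boundaries sigma m d.-1].

(** The cycle [c] represents the generator of the bar.  If [c'] is homologous to
    it up to older cycles, then [lam] takes the value 1 on the class of [c'],
    hence that class is not killed before [d]. *)
Lemma splits_bar_paired m (b d : 'I_K.+1) : (b < d)%N ->
  splits_bar (persistent_homology sigma m) b d -> exists c, paired m b d c.
Proof.
move=> bd [g [lam [lg gd old young]]].
pose cls (k : 'I_K.+1) c : homology sigma m k :=
  clsv (boundaries_in_cycles sigma m k) (vsproj (cycles sigma m k) c).
have clsM (i j : 'I_K.+1) (ij : (i <= j)%N) c : c \in cycles sigma m i ->
    pm_map (persistent_homology sigma m) ij (cls i c) = cls j c.
  move=> ci; rewrite /= homology_fun_cls//.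
  rewrite (_ : cycle_incl _ _ = vsproj (cycles sigma m j) c)//.
  by rewrite /cycle_incl vsprojK.
have cls0 : forall (k : 'I_K.+1) c, c \in cycles sigma m k ->
    (cls k c == 0) = (c \in boundaries sigma m k).
  move=> k c ck; rewrite /cls -(linear0 (clsv _)) clsv_eq subr0 -memv_preim.
  by rewrite lfunE /= vsprojK.
have d0 : (0 < d)%N by exact: leq_ltn_trans bd.
have bd' : (b <= d.-1)%N by rewrite -ltnS prednK.
have dK : (d.-1 < K.+1)%N := leq_ltn_trans (leq_pred d) (ltn_ord d).
pose c := vsval (reprv g); have cb : c \in cycles sigma m b by apply: subvsP.
have gc : g = cls b c by rewrite /cls /c vsvalK reprvK.
exists c; split => //.
  have bd1 := ltnW bd.
  by rewrite -cls0 ?(subvP (cycles_sub _ _ bd1))// -(clsM _ _ bd1)// -gc gd.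
move=> c' c'b cc'; apply/negP => c'd.
have bdK : (b <= Ordinal dK)%N by [].
have lam0 : lam (cls b c') = 0.
  apply: (young _ bdK); first by rewrite /= prednK.
  rewrite clsM//; apply/eqP; rewrite cls0//.
  by rewrite (subvP (cycles_sub _ _ bd')).
(* It remains to see that lam vanishes on the older cycle c - c'. *)
suff : lam (cls b (c - c')) = 0.
  rewrite /cls linearB /= linearB /= linearB /= -!/(cls b _).
  by rewrite -gc lg lam0 subr0 => /eqP; rewrite oner_eq0.
case: (posnP b) => [b0|b0].
  move: cc'; rewrite b0 memv_cap chains0 memv0 => /andP[/eqP-> _].
  by rewrite /cls !linear0.
have bK : (b.-1 < K.+1)%N by rewrite (leq_ltn_trans (leq_pred _)).
have bb : (Ordinal bK <= b)%N by rewrite leq_pred.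
by rewrite -(clsM _ _ bb)// old//= prednK.
Qed.

(** * Faces and cofaces along a filtration *)

Lemma F2_neq0 (a : 'F_2) : a != 0 -> a = 1.
Proof. by case: a => [[|[|//]] a2] // _; apply: val_inj. Qed.

Lemma F2_addrr (a : 'F_2) : a + a = 0.
Proof. exact: addrr_pchar2 (pchar_Fp (isT : prime 2)) a. Qed.

Lemma F2_addr_eq0 (a b : 'F_2) : (a + b == 0) = (a == b).
Proof. by rewrite -[RHS]subr_eq0 (oppr_pchar2 (pchar_Fp (isT : prime 2))). Qed.

Definition coface (i j : 'I_K) : bool :=
  (sigma j `<=` sigma i) && (#|` sigma i| == #|` sigma j|.+1).

Lemma cofaceP i j :
  reflect (exists2 v, v \notin sigma j & sigma i = v |` sigma j) (coface i j).
Proof.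
apply: (iffP andP) => [[sji /eqP card]|[v vj ->]]; last first.
  by rewrite fsubsetU1 cardfsU1 vj.
have /cardfs1P[v iDj] : #|` sigma i `\` sigma j| == 1%N.
  by rewrite cardfsDS// card subSn// subnn.
exists v; first by have := in_fset1 v v; rewrite -iDj eqxx inE => /andP[].
apply/fsetP => x; rewrite in_fset1U -in_fset1 -iDj in_fsetD.
by case: (boolP (x \in sigma j)) => [/(fsubsetP sji)->|]; rewrite ?orbF.
Qed.

Lemma boundary_mxE i j : boundary_mx sigma i j = (coface i j)%:R.
Proof. by rewrite mxE. Qed.

Lemma boundary_eq0 z j : (forall i, coface i j -> z 0 i = 0) ->
  boundary sigma z 0 j = 0.
Proof.
move=> zj; rewrite boundaryE big1// => i _; rewrite boundary_mxE.
by case: (boolP (coface i j)) => [/zj->|_]; rewrite ?mul0r ?mulr0.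
Qed.

Lemma boundary_eq z z' j : (forall i, coface i j -> z 0 i = z' 0 i) ->
  boundary sigma z 0 j = boundary sigma z' 0 j.
Proof.
move=> zj; rewrite !boundaryE; apply: eq_bigr => i _; rewrite boundary_mxE.
by case: (boolP (coface i j)) => [/zj->|_]; rewrite ?mulr0.
Qed.

Lemma coefS (i : 'I_K) z : coef i.+1 z = z 0 i.
Proof. by rewrite /coef (big_pred1 i)// => j; rewrite eqSS. Qed.

(** Persistent volumes in terms of supports; [b] and [d] are shifted by one
    because simplices are numbered from 1 in the filtration but from 0 in
    ['I_K]. *)
Lemma persistent_volumeP (b d : 'I_K) z : has_dim n (sigma d) ->
  persistent_volume sigma b.+1 d.+1 z <->
  [/\ forall i, z 0 i != 0 -> has_dim n (sigma i),
      z 0 d = 1 /\ forall i, z 0 i != 0 -> i = d \/ (b < i < d)%N,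
      forall i, between sigma b.+1 d.+1 n.-1 i -> boundary sigma z 0 i = 0
    & boundary sigma z 0 b != 0].
Proof.
move=> dn; have sumE (alpha : 'I_K -> 'F_2) i :
    (simplex_chain K d.+1
      + \sum_(j | between sigma b.+1 d.+1 n j)
          alpha j *: simplex_chain K j.+1) 0 i
    = (i == d)%:R + (if between sigma b.+1 d.+1 n i then alpha i else 0).
  rewrite !mxE eqSS summxE; congr (_ + _); rewrite big_mkcond (bigD1 i)//=.
  rewrite big1 ?addr0; first by rewrite !mxE eqxx mulr1.
  move=> j ji; case: ifP => // _; rewrite !mxE eqSS eq_sym.
  by rewrite (inj_eq val_inj) (negPf ji) mulr0.
split=> [[zK [alpha zE] zb zb0]|[zn [zd zi] zb zb0]].
  rewrite coefS in zb0; split => //.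
  - by move=> i /(mem_chainsP _ _ _ zK)/andP[].
  - split; first by rewrite zE sumE eqxx /between ltnn andbF addr0.
    move=> i; rewrite zE sumE; case: (eqVneq i d) => [|_]; first by left.
    rewrite add0r /between !ltnS.
    by case: ifP => [/andP[]|]; [right|rewrite eqxx].
  - by move=> i /zb; rewrite coefS.
split; last by rewrite coefS.
- by apply/mem_chainsP => i zi0; rewrite zn ?andbT.
- exists (fun i => z 0 i); apply/rowP => i; rewrite sumE.
  case: (eqVneq i d) => [->|id]; first by rewrite zd /between ltnn andbF addr0.
  rewrite add0r; case: ifPn => // nb; apply/eqP; apply: contraNT nb => z0.
  rewrite /between zn// !ltnS andbT; case: (zi _ z0) => // idE.
  by rewrite idE eqxx in id.
- by move=> i /zb; rewrite coefS.
Qed.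

Section Complex.
Variable X : {fset simplex R n}.
Hypothesis sigma_inj : injective sigma.
Hypothesis X_sigma : X = [fset sigma i | i : 'I_K].
Hypothesis X_complex : simplicial_complex X.
Hypothesis X_filtration :
  forall k, (1 <= k <= K)%N -> subcomplex (stage sigma k) X.

Lemma sigma_in i : sigma i \in X.
Proof. by rewrite X_sigma; apply: in_imfset. Qed.

Lemma sigma_neq0 i : sigma i != fset0.
Proof. by have [/(_ _ (sigma_in i))[]] := X_complex. Qed.

(** Each stage is closed under faces, so that a face enters the filtration before
    its cofaces. *)
Lemma coface_lt i j : coface i j -> (j < i)%N.
Proof.
move=> ij; have /andP[ji /eqP card] := ij.
have [_ faceX] : subcomplex (stage sigma i.+1) X.
  by apply: X_filtration; rewrite ltn_ord.
have : sigma j \in stage sigma i.+1.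
  apply: faceX ji (sigma_neq0 j).
  by apply/imfsetP; exists i => //=; rewrite inE.
case/imfsetP => k; rewrite inE /= ltnS => ki /sigma_inj jk; subst k.
rewrite ltn_neqAle ki andbT; apply: contra_eqN card => /eqP/val_inj->.
by rewrite neq_ltn ltnSn.
Qed.

(** A simplex and a face of codimension 2 have either no simplex in between, or
    exactly two, obtained by adding back one of the two missing vertices. *)
Lemma boundaryK z : boundary sigma (boundary sigma z) = 0.
Proof.
apply/rowP => k; rewrite boundaryE [RHS]mxE.
under eq_bigr do rewrite boundaryE mulr_suml.
rewrite exchange_big big1//= => i _.
under eq_bigr do rewrite -mulrA !boundary_mxE -natrM mulnb.
rewrite -mulr_sumr -natr_sum -big_mkcond/= sum1_card.
case: (pickP (fun j => coface i j && coface j k)) => [j|none]; last first.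
  by rewrite eq_card0 ?mulr0// => j; rewrite none.
move=> /andP[/cofaceP[w wj iE] /cofaceP[v vk jE]].
have wk : w \notin sigma k by apply: contra wj; rewrite jE => /fset1Ur->.
have wv : w != v by apply: contraNneq wj => ->; rewrite jE fset1U1.
have : w |` sigma k \in X.
  have [_ faceX _] := X_complex; apply: faceX (sigma_in i) _ _.
    by rewrite iE jE fsetUS// fsubsetU1.
  by apply/fset0Pn; exists w; apply: fset1U1.
rewrite X_sigma => /imfsetP[j' _ /= j'E].
have jj' : j != j'.
  apply: contraNneq wj => ->; by rewrite -j'E fset1U1.
rewrite (@eq_card _ _ (mem [set j; j'])) ?cards2 ?jj' ?[2%:R]F2_addrr ?mulr0//.
move=> x; rewrite !inE [LHS]unfold_in /=.
apply/andP/orP => [[/cofaceP[y yx] ixE /cofaceP[t tk xE]]|].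
  have : t \in sigma i by rewrite ixE xE !in_fset1U eqxx orbT.
  rewrite iE jE !in_fset1U (negPf tk) orbF => /orP[]/eqP tE; subst t.
    by right; apply/eqP/sigma_inj; rewrite xE.
  by left; apply/eqP/sigma_inj; rewrite xE.
case=> /eqP->.
  by split; apply/cofaceP; [exists w|exists v].
split; apply/cofaceP; last by exists w.
exists v; last by rewrite iE jE -j'E fsetUCA.
by rewrite -j'E in_fset1U negb_or vk eq_sym wv.
Qed.

Lemma coface_le2 j : #|` sigma j| = n -> (#|[set i | coface i j]| <= 2)%N.
Proof.
move=> jn; rewrite leqNgt; apply/negP => /card_gt2P[i1 [i2 [i3 [[]]]]].
rewrite !inE => /cofaceP[v1 v1j i1E] /cofaceP[v2 v2j i2E] /cofaceP[v3 v3j i3E].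
have neq i i' v v' : sigma i = v |` sigma j -> sigma i' = v' |` sigma j ->
    i != i' -> v != v'.
  move=> iE i'E; apply: contraNneq => vv'.
  by apply/eqP/sigma_inj; rewrite iE i'E vv'.
case=> /(neq _ _ _ _ i1E i2E) v12 /(neq _ _ _ _ i2E i3E) v23.
move=> /(neq _ _ _ _ i3E i1E).
apply: (no_three_cofaces X_complex jn) v12 v23 => //;
  by rewrite -?i1E -?i2E -?i3E sigma_in.
Qed.

(** * Intersecting persistent volumes *)

(** Over the field with two elements a chain is the set of simplices in its
    support, and this product of coefficients is the intersection of two such
    sets. *)
Definition meet z z' : chain K := \row_i (z 0 i * z' 0 i).

Lemma boundary_sum_cofaces z j :
  boundary sigma z 0 j = \sum_(i in [set i | coface i j]) z 0 i.
Proof.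
rewrite boundaryE [RHS]big_mkcond; apply: eq_bigr => i _.
by rewrite boundary_mxE inE; case: ifP; rewrite ?mulr1 ?mulr0.
Qed.

(** The face [sigma j] has at most two cofaces.  A chain whose boundary avoids it
    contains both or neither of them (none if there is only one), and this
    property is stable under intersection.  With three or more cofaces it would
    not be. *)
Lemma boundary_meet z z' j : #|` sigma j| = n ->
  boundary sigma z 0 j = 0 -> boundary sigma z' 0 j = 0 ->
  boundary sigma (meet z z') 0 j = 0.
Proof.
move=> jn; rewrite !boundary_sum_cofaces; have := coface_le2 jn.
move: [set i | _] => A; rewrite leq_eqVlt ltnS leq_eqVlt ltnS leqn0 cards_eq0.
case/or3P => [/cards2P[x [y [xy ->]]]|/cards1P[x ->]|/eqP->].
- rewrite !big_setU1 ?inE//= !big_set1 !mxE.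
  move=> /eqP; rewrite F2_addr_eq0 => /eqP->.
  by move=> /eqP; rewrite F2_addr_eq0 => /eqP->; exact: F2_addrr.
- by rewrite !big_set1 mxE => -> _; rewrite mul0r.
- by rewrite !big_set0.
Qed.

Section Pair.
Variables (b d : 'I_K) (c : chain K).
Hypothesis n_gt0 : (0 < n)%N.
Hypothesis bd : (b < d)%N.
Hypothesis cP : paired n.-1 b.+1 d.+1 c.

(** Otherwise [c] would already be a cycle before [sigma b] is added. *)
Lemma paired_birth : c 0 b = 1.
Proof.
case: cP => cc cd young; apply: F2_neq0; apply/negP => /eqP cb.
suff c0 : c - 0 \in cycles sigma n.-1 b.
  by have := young 0 (mem0v _) c0; rewrite mem0v.
rewrite subr0; move: cc; rewrite !memv_cap => /andP[/mem_chainsP cc ->].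
rewrite andbT; apply/mem_chainsP => i ci; have /andP[ib ->] := cc i ci.
rewrite andbT ltn_neqAle -ltnS ib andbT; apply: contraNneq ci => /val_inj->.
by rewrite cb.
Qed.

(** A boundary [boundary w] that appears before [sigma d] and has no simplex
    strictly between [b] and [d] is a cycle at the birth index.  If it contained
    [sigma b], it would differ from [c] by an older cycle, yet bound too early. *)
Lemma paired_death w : w \in chains sigma n d ->
  (forall i, between sigma b.+1 d.+1 n.-1 i -> boundary sigma w 0 i = 0) ->
  boundary sigma w 0 b = 0.
Proof.
case: cP => cc cd young wd wi; apply/eqP/negP => /negP wb.
have cyc : boundary sigma w \in cycles sigma n.-1 b.+1.
  rewrite memv_cap memv_ker boundaryK eqxx andbT.
  apply/mem_chainsP => i bi.
  have [j ji wj] : exists2 j, coface j i & w 0 j != 0.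
    apply/exists_inP; apply: contraNT bi => /exists_inPn none.
    by apply/eqP/boundary_eq0 => j /none/negbNE/eqP.
  have /andP[jd jn] := mem_chainsP _ _ _ wd _ wj.
  have i_n : has_dim n.-1 (sigma i).
    case/andP: ji; rewrite (eqP jn) => _ /eqP[ni].
    by rewrite /has_dim -ni prednK.
  rewrite i_n andbT ltnS leqNgt; apply: contraNN bi => bi; apply/eqP/wi.
  by rewrite /between i_n !ltnS bi (ltn_trans (coface_lt ji)).
suff /(young _ cyc) : c - boundary sigma w \in cycles sigma n.-1 b.
  by rewrite memv_img// prednK.
move: cc cyc; rewrite !memv_cap => /andP[/mem_chainsP c1 c2].
  move=> /andP[/mem_chainsP w1 w2]; rewrite [X in _ && X]memvB// andbT.
  apply/mem_chainsP => i ci.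
  have ib : i != b.
    apply: contraNneq ci => ->; rewrite mxE [in X in _ + X]mxE paired_birth.
    by rewrite (F2_neq0 wb) subrr.
  have /andP[ib' ->] : (i < b.+1)%N && has_dim n.-1 (sigma i).
    case: (eqVneq (c 0 i) 0) => [ci0|/c1//]; apply: w1.
    by move: ci; rewrite !mxE ci0 add0r oppr_eq0.
  by rewrite andbT ltn_neqAle -ltnS ib' andbT.
Qed.

(** A chain [w] with boundary [c] contains [sigma d], since [c] does not bound
    earlier.  Its simplices older than [sigma b] only have faces older than
    [sigma b], so discarding them leaves the boundary unchanged from index [b]
    on; what remains is a persistent volume. *)
Lemma persistent_volume_exists : has_dim n (sigma d) /\
  exists z, persistent_volume sigma b.+1 d.+1 z.
Proof.
case: cP => cc cd young.
case/memv_imgP: (cd); rewrite prednK// => w wd cE.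
move: (wd) => /mem_chainsP wP.
have wd0 : w 0 d != 0.
  apply/eqP => wd0; have /negP : c \notin boundaries sigma n.-1 d.
    by apply: young; rewrite // subrr mem0v.
  case; rewrite cE memv_img// prednK//=; apply/mem_chainsP => i wi.
  have /andP[id ->] := wP _ wi; rewrite andbT ltn_neqAle -ltnS id andbT.
  by apply: contraNneq wi => /val_inj->; rewrite wd0.
have /andP[_ dn] := wP _ wd0; split => //.
pose z : chain K := \row_i (if (b < i)%N then w 0 i else 0).
have zE (i : 'I_K) : (b <= i)%N -> boundary sigma z 0 i = c 0 i.
  move=> bi; rewrite cE; apply: boundary_eq => j /coface_lt ij.
  by rewrite mxE (leq_ltn_trans bi ij).
exists z; apply/persistent_volumeP => //; split.
- by move=> i; rewrite mxE; case: ifP; rewrite ?eqxx// => _ /wP/andP[].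
- split; first by rewrite mxE bd (F2_neq0 wd0).
  move=> i; rewrite mxE; case: ifP; rewrite ?eqxx// => bi /wP/andP[].
  by rewrite ltnS leq_eqVlt => /predU1P[/val_inj|id]; [left|right; rewrite id].
- move=> i /andP[/andP[bi _] _]; rewrite zE; last exact: ltnW.
  move: cc; rewrite memv_cap => /andP[/mem_chainsP cc _].
  by apply: contraTeq bi => /cc/andP[bi _]; rewrite -leqNgt.
- by rewrite zE// paired_birth oner_eq0.
Qed.

(** Only the condition at [sigma b] is not immediate.  The difference
    [z - meet z z'] no longer contains [sigma d], so its boundary does not
    contain [sigma b]; hence [z] and the intersection have the same coefficient
    there. *)
Lemma persistent_volume_meet z z' :
  persistent_volume sigma b.+1 d.+1 z -> persistent_volume sigma b.+1 d.+1 z' ->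
  persistent_volume sigma b.+1 d.+1 (meet z z').
Proof.
have [dn _] := persistent_volume_exists.
move=> /(persistent_volumeP _ _ dn)[zn [zd zi] zbd zb].
move=> /(persistent_volumeP _ _ dn)[z'n [z'd z'i] z'bd z'b].
have meet_neq0 i : meet z z' 0 i != 0 -> z 0 i != 0.
  by rewrite mxE mulf_eq0 negb_or => /andP[].
have mbd i : between sigma b.+1 d.+1 n.-1 i ->
    boundary sigma (meet z z') 0 i = 0.
  move=> ibd; apply: boundary_meet; rewrite ?zbd ?z'bd//.
  by case/andP: ibd => _ /eqP->; rewrite prednK.
apply/persistent_volumeP => //; split => //.
- by move=> i /meet_neq0/zn.
- by split=> [|i /meet_neq0/zi//]; rewrite mxE zd z'd mulr1.
suff : boundary sigma (z - meet z z') 0 b = 0.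
  by rewrite linearB !mxE => /eqP; rewrite subr_eq0 => /eqP<-.
apply: paired_death => [|i ibd].
  apply/mem_chainsP => i; rewrite 2!mxE => yi.
  have zi0 : z 0 i != 0.
    by apply: contraNneq yi => zi0; rewrite mxE zi0 mul0r subrr.
  rewrite zn// andbT; case: (zi _ zi0) => [id|/andP[]//].
  by move: yi; rewrite mxE id zd z'd mulr1 subrr eqxx.
by rewrite linearB !mxE zbd// mbd// subrr.
Qed.

(** By minimality [z] is no larger than its intersection with [z']. *)
Lemma optimal_volume_sub z z' : optimal_volume sigma b.+1 d.+1 z ->
  persistent_volume sigma b.+1 d.+1 z' -> forall i, z 0 i != 0 -> z' 0 i != 0.
Proof.
have [dn _] := persistent_volume_exists.
case=> zP zmin z'P i zi.
have := zmin _ (persistent_volume_meet zP z'P).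
set A := [set i | has_dim n (sigma i) & z 0 i != 0]%SET.
set B := [set i | has_dim n (sigma i) & meet z z' 0 i != 0]%SET => AB.
have BA : B \subset A.
  apply/fintype.subsetP => j; rewrite !inE mxE mulf_eq0 negb_or.
  by case/and3P => -> ->.
have /setP/(_ i) : B = A by apply/eqP; rewrite eqEcard BA.
case/(persistent_volumeP _ _ dn): zP => /(_ _ zi) iN _ _ _.
by rewrite !inE iN zi /= mxE mulf_eq0 negb_or => /andP[].
Qed.

Lemma optimal_volume_unique : exists! z, optimal_volume sigma b.+1 d.+1 z.
Proof.
have [dn [z0 z0P]] := persistent_volume_exists.
case: (@arg_minnP _ z0 (fun z => `[< persistent_volume sigma b.+1 d.+1 z >])
  (norm0 sigma)) => [|z /asboolP zP zmin]; first exact/asboolP.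
have zO : optimal_volume sigma b.+1 d.+1 z.
  by split=> // z' z'P; apply/zmin/asboolP.
exists z; split => // z' z'O; have [z'P _] := z'O.
have zz' := optimal_volume_sub zO z'P; have z'z := optimal_volume_sub z'O zP.
apply/rowP => i; case: (eqVneq (z 0 i) 0) => [zi|zi].
  by case: (eqVneq (z' 0 i) 0) => [->//|/z'z]; rewrite zi eqxx.
by rewrite (F2_neq0 zi) (F2_neq0 (zz' _ zi)).
Qed.

End Pair.
End Complex.
End Chains.

Theorem theorem7 (R : realType) (n K : nat) (n_gt0 : (0 < n)%N)
    (X : {fset simplex R n}) (sigma : 'I_K -> simplex R n)
    (sigma_inj : injective sigma)
    (X_sigma : X = [fset sigma i | i : 'I_K])
    (X_complex : simplicial_complex X)
    (X_pure : forall (k : nat) (s : simplex R n),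
       (k < n)%N -> s \in X -> has_dim k s ->
       exists t : simplex R n, [/\ t \in X, has_dim n t & s `<=` t])
    (X_convex : convex_set (polyhedron X))
    (X_filtration : forall k : nat, (1 <= k <= K)%N ->
       subcomplex (stage sigma k) X)
    (D : seq (bar K))
    (D_diagram : persistence_diagram (persistent_homology sigma n.-1) D)
    (b d : 'I_K.+1) (bd_D : (b, Some d) \in D) :
  exists! z : chain K, optimal_volume sigma b d z.
Proof.
have bd : (b < d)%N by case: D_diagram => /allP/(_ _ bd_D).
have [c cP] := splits_bar_paired bd (persistence_diagram_splits D_diagram bd_D).
case: b d bd cP {bd_D} => [[|b] bK] [[|d] dK] //= bd cP.
  (* Nothing is born at index 0, where the complex is empty. *)
  have [cc cd young] := cP; exfalso.
  have c0 : c = 0.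
    by apply/eqP; move: cc; rewrite memv_cap chains0 memv0 => /andP[].
  by have := young 0 (mem0v _); rewrite c0 subrr !mem0v => /(_ isT).
exact: (@optimal_volume_unique _ _ _ _ X _ _ _ _
         (Ordinal (bK : b < K)%N) (Ordinal (dK : d < K)%N) c).
Qed.
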